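(* Let $\mathcal{A}^{[m,n]}=\bigoplus_{\mathsf{g}\in\mathsf{G}^{[n']}}\mathcal{A}(\mathsf{g})$ be a multiary higher power $\mathsf{G}$-graded polyadic $\Bbbk$-algebra, where $\ell_n$ and $\ell_{n'}$ are the polyadic powers of the $n$-ary algebra multiplication and of the $n'$-ary grading group multiplication, respectively, in the grading compatibility condition. Then the arity $n$ of the multiplication of $\mathcal{A}^{[m,n]}$ and the arity $n'$ of the grading group $\mathsf{G}^{[n']}$ are connected by $$\ell_{n'}(n'-1)=\ell_n(n-1).$$
   Context: **Polyadic operations.** An $n$-ary operation $\mu^{[n]}$ is totally associative if the result of composing it with itself does not depend on the position of the inner operation. Composing an associative $n$-ary operation $\ell$ times (polyadic power $\ell$; notation $\mu^{[n]\circ\ell}$) gives an operation on words of length exactly $\ell(n-1)+1$. An $n'$-ary group is a set $G$ with a totally associative $n'$-ary operation $\mu_g^{[n']}$ such that every $\mathsf{g}\in G$ has a unique querelement $\bar{\mathsf{g}}$, defined by $\mu_g^{[n']}[\mathsf{g},\ldots,\mathsf{g},\bar{\mathsf{g}}]=\mathsf{g}$ ($n'-1$ copies of $\mathsf{g}$). Grading groups are assumed commutative. **Polyadic algebra.** $\mathcal{A}^{[m,n]}=\langle A\mid\nu_a^{[m]},\mu_a^{[n]}\rangle$ is an algebra over an ordinary (binary) field $\Bbbk$ with a totally associative $m$-ary addition $\nu_a^{[m]}$ and a totally associative $n$-ary multiplication $\mu_a^{[n]}$ that is distributive over the addition and compatible with scalars. Standing assumption: $\mu_a^{[n]}$ and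 $\mu_g^{[n']}$ are nonderived, i.e. they are not compositions of binary operations only. **Higher power grading.** A multiary higher power $\mathsf{G}$-graded polyadic $\Bbbk$-algebra is a direct sum decomposition of $\Bbbk$-vector spaces $\mathcal{A}^{[m,n]}=\bigoplus_{\mathsf{g}\in\mathsf{G}^{[n']}}\mathcal{A}(\mathsf{g})$ such that $$\mu_a^{[n]\circ\ell_n}[\mathcal{A}(\mathsf{g}_1),\mathcal{A}(\mathsf{g}_2),\ldots,\mathcal{A}(\mathsf{g}_{\ell_n(n-1)+1})]\subseteq\mathcal{A}\left(\mu_g^{[n']\circ\ell_{n'}}[\mathsf{g}_1,\mathsf{g}_2,\ldots,\mathsf{g}_{\ell_{n'}(n'-1)+1}]\right).$$ It is strongly graded if equality holds. In this condition the word of degrees $\mathsf{g}_1,\ldots,\mathsf{g}_{\ell_n(n-1)+1}$ of the factors on the left is the same word as the one $\mathsf{g}_1,\ldots,\mathsf{g}_{\ell_{n'}(n'-1)+1}$ multiplied in the grading group on the right. *)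

(* Defs.v *)
From Stdlib Require Import List.
From mathcomp Require Import all_boot all_fingroup all_algebra.

Set Implicit Arguments.
Unset Strict Implicit.
Unset Printing Implicit Defensive.

Import GRing.Theory.

Section PolyadicOperations.
Variables (T : Type) (n : nat) (mu : n.-tuple T -> T).

(* [None] unless the word has exactly [n] letters. *)
Definition apply_word (w : seq T) : option T := omap mu (insub w).

(* The polyadic power: [mu] composed [l] times, as a partial operation on
   words; it is defined exactly on the words of length l (n - 1) + 1.  The inner
   operation is always put in the leftmost position, which is immaterial for a
   totally associative [mu]. *)
Fixpoint polypow (l : nat) (w : seq T) : option T :=
  match l with
  | 0 => if w is [:: x] then Some x else None
  | l'.+1 => if apply_word (take n w) is Some x
             then polypow l' (x :: drop n w) else None
  end.

(* Both sides are [None] unless the common word has length 2 n - 1. *)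
Definition totally_associative : Prop :=
  forall (u v u' v' : seq T) (t t' : n.-tuple T),
    u ++ t ++ v = u' ++ t' ++ v' ->
    apply_word (u ++ mu t :: v) = apply_word (u' ++ mu t' :: v').

Definition polyadic_commutative : Prop :=
  forall (s : 'S_n) (t : n.-tuple T), mu [tuple tnth t (s i) | i < n] = mu t.

Definition unique_querelements : Prop :=
  forall g : T, exists! q : T, apply_word (rcons (nseq n.-1 g) q) = Some g.

(* Replacement of the [i]-th letter. *)
Definition subst_letter (t : n.-tuple T) (i : 'I_n) (x : T) : n.-tuple T :=
  [tuple if j == i then x else tnth t j | j < n].

End PolyadicOperations.

(* [mu] is the (n - 1)-st polyadic power of one associative binary operation.
   Allowing compositions of several unrelated binary operations would make
   every operation derived (Sierpinski). *)
Definition derived (T : Type) (n : nat) (mu : n.-tuple T -> T) : Prop :=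
  exists2 op : 2.-tuple T -> T, totally_associative op &
    forall t : n.-tuple T, polypow op n.-1 t = Some (mu t).

Record polyadic_group (n : nat) := PolyadicGroup {
  pg_sort :> Type;
  pg_mul : n.-tuple pg_sort -> pg_sort;
  pg_mulA : totally_associative pg_mul;
  pg_quer : unique_querelements pg_mul
}.

(* The underlying vector space has the m-ary operation [pa_add] as its addition:
   a commutative m-ary group on which the binary field [k] acts.  Since only
   words of length l (m - 1) + 1 can be added, distributivity over the addition
   of scalars involves sums of [m] scalars.  For m = 2 these are the usual
   vector space axioms. *)
Record polyadic_algebra (k : fieldType) (m n : nat) := PolyadicAlgebra {
  pa_sort :> Type;
  pa_add : m.-tuple pa_sort -> pa_sort;
  pa_mul : n.-tuple pa_sort -> pa_sort;
  pa_scale : k -> pa_sort -> pa_sort;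
  pa_addA : totally_associative pa_add;
  pa_addC : polyadic_commutative pa_add;
  pa_addq : unique_querelements pa_add;
  pa_scale1 : forall x, pa_scale 1%R x = x;
  pa_scaleA : forall a b x, pa_scale a (pa_scale b x) = pa_scale (a * b)%R x;
  pa_scaleDr : forall a (t : m.-tuple pa_sort),
    pa_scale a (pa_add t) = pa_add (map_tuple (pa_scale a) t);
  pa_scaleDl : forall (c : 'I_m -> k) x,
    pa_scale (\sum_(i < m) c i)%R x = pa_add [tuple pa_scale (c i) x | i < m];
  pa_mulA : totally_associative pa_mul;
  pa_mulD : forall (t : n.-tuple pa_sort) (i : 'I_n) (s : m.-tuple pa_sort),
    pa_mul (subst_letter t i (pa_add s)) =
    pa_add (map_tuple (fun x => pa_mul (subst_letter t i x)) s);
  pa_mulZ : forall (t : n.-tuple pa_sort) (i : 'I_n) a,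
    pa_mul (subst_letter t i (pa_scale a (tnth t i))) = pa_scale a (pa_mul t)
}.

Section Grading.
Variables (k : fieldType) (m n : nat) (A : polyadic_algebra k m n).

Definition subspace (S : A -> Prop) : Prop :=
  [/\ exists x, S x,
      forall t : m.-tuple A, (forall i, S (tnth t i)) -> S (pa_add t)
    & forall a x, S x -> S (pa_scale a x)].

(* Internal direct sum of subspaces: every vector is a sum of components of
   distinct degrees, and the components are determined by their sum.  Zero
   vectors 0 x complete a word of components to a length l (m - 1) + 1 on which
   the m-ary addition is defined. *)
Definition direct_sum (I : Type) (V : I -> A -> Prop) : Prop :=
  [/\ forall i, subspace (V i),
      forall a : A, exists (r : seq I) (x z : seq A) (l : nat),
        [/\ List.NoDup r, List.Forall2 V r x &
            polypow (@pa_add k m n A) l (x ++ map (pa_scale 0%R) z) = Some a]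
    & forall (r : seq I) (x y z : seq A) (l : nat) (a : A),
        List.NoDup r -> List.Forall2 V r x -> List.Forall2 V r y ->
        polypow (@pa_add k m n A) l (x ++ map (pa_scale 0%R) z) = Some a ->
        polypow (@pa_add k m n A) l (y ++ map (pa_scale 0%R) z) = Some a ->
        x = y].

(* The inclusion
     mu_a^ln [V g_1, V g_2, ...] <= V (mu_g^lg [g_1, g_2, ...])
   for every word [w] of degrees on which the left-hand side is defined; the
   right-hand side multiplies the same word [w]. *)
Definition higher_power_graded (n' : nat) (G : polyadic_group n')
    (ln lg : nat) (V : G -> A -> Prop) : Prop :=
  direct_sum V /\
  forall (w : seq G) (x : seq A) (a : A),
    List.Forall2 V w x -> polypow (@pa_mul k m n A) ln x = Some a ->
    exists2 g : G, polypow (@pg_mul n' G) lg w = Some g & V g a.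

End Grading.

(* Main.v *)
Require Import Defs.
From mathcomp Require Import all_boot all_fingroup all_algebra.
From mathcomp Require Import zify.

(** The [l]-th polyadic power of an [n]-ary operation multiplies exactly the
    words of length [l * (n - 1) + 1] ([polypow_isSome]).  In the grading
    condition one and the same word of degrees is read by both powers: a word
    of [ln * (n - 1) + 1] homogeneous factors has a product in the algebra, so
    its word of degrees must have a product in the grading group, which forces
    its length to be [lg * (n' - 1) + 1] as well.

    Such a word exists as soon as the grading group has an element [g]: every
    homogeneous component is a subspace, hence nonempty, and a vector of
    degree [g] can be repeated.  The axioms of a polyadic group leave room for
    an empty carrier, but an operation on the empty set is derived
    ([empty_derived]), so nonderivedness of the grading group provides [g]. *)

(** Each composition replaces [n] letters by one, shortening the word by
    [n - 1], until a single letter remains. *)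
Lemma polypow_isSome (T : Type) (n : nat) (mu : n.-tuple T -> T)
    (l : nat) (w : seq T) :
  0 < n -> isSome (polypow mu l w) = (size w == l * (n - 1) + 1).
Proof.
move=> n_gt0; elim: l w => [|l IHl] w /=; first by case: w => [|x []].
rewrite /apply_word; case: insubP => [t szt _|szt] /=.
  by move: szt; rewrite IHl /= size_drop size_take_min mulSn; lia.
move: szt; rewrite size_take_min mulSn; move: (l * _) => p szt.
by apply/esym/eqP; lia.
Qed.

Lemma empty_derived (T : Type) (n : nat) (mu : n.-tuple T -> T) :
  0 < n -> (T -> False) -> derived mu.
Proof.
move=> n_gt0 T0; exists (fun t : 2.-tuple T => thead t).
  by move=> u v u' v' t; case: (T0 (thead t)).
by move=> t; case: (T0 (tnth t (Ordinal n_gt0))).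
Qed.

Lemma Forall2_nseq (S T : Type) (R : S -> T -> Prop) (N : nat) (x : S) (y : T) :
  R x y -> List.Forall2 R (nseq N x) (nseq N y).
Proof. by move=> Rxy; elim: N => [|N IHN] /=; constructor. Qed.

Theorem theorem7p2 (k : fieldType) (m n n' : nat)
    (hm : 1 < m) (hn : 1 < n) (hn' : 1 < n')
    (A : polyadic_algebra k m n) (G : polyadic_group n')
    (GC : polyadic_commutative (@pg_mul n' G))
    (A_nonderived : ~ derived (@pa_mul k m n A))
    (G_nonderived : ~ derived (@pg_mul n' G))
    (ln lg : nat) (V : G -> A -> Prop)
    (gradedA : higher_power_graded ln lg V) :
  lg * (n' - 1) = ln * (n - 1).
Proof.
have [[Vsub _ _] Vmul] := gradedA.
(* The conclusion is decidable, so an element of [G] may be assumed without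
   excluded middle. *)
apply/eqP/negPn/negP => /eqP neq_len.
apply: G_nonderived; apply: empty_derived => [|g]; first exact: ltnW.
have [[x Vgx] _ _] := Vsub g.
pose N := ln * (n - 1) + 1.
have := @polypow_isSome _ _ (@pa_mul k m n A) ln (nseq N x) (ltnW hn).
rewrite size_nseq eqxx; case Ea: (polypow _ _ _) => [a|] // _.
have [h Eh _] := Vmul _ _ _ (@Forall2_nseq _ _ V N g x Vgx) Ea.
have := @polypow_isSome _ _ (@pg_mul n' G) lg (nseq N g) (ltnW hn').
by rewrite Eh size_nseq /N => /esym/eqP/addIn/esym.
Qed.
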